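(* Let $\phi_3(x)=\sqrt2\,\mathrm{sech}(x)$ and $T(x)=\int_{\mathbb R} e^{-\sqrt2|x-y|}\mathrm{sech}^2(y)\,dy$. Define the real functions \[ R_1=-x\phi_3\phi_3'-\tfrac{1}{4\sqrt2}(3-\phi_3^2)T-\tfrac{\phi_3'}{2\sqrt2\,\phi_3}T',\qquad R_2=\tfrac12\phi_3^2+\tfrac{3}{4\sqrt2}T+\tfrac{\phi_3'}{2\sqrt2\,\phi_3}T', \] \[ E=\tfrac12\phi_3\big(\tfrac14-\log\phi_3\big)+\tfrac12 x\phi_3',\qquad F=E+\phi_3\log\phi_3, \] \[ \Delta_1=F\big(3(1-\phi_3^2)^2-1\big)+\phi_3(1-\phi_3^2)^2+6\phi_3(1-\phi_3^2)R_1-2\phi_3R_2,\qquad \Delta_2=F(1-\phi_3^2)+\phi_3R_1+\phi_3(1-\phi_3^2)R_2, \] \[ h_{3,1}=\tfrac12\phi_3^2\cos x+\tfrac{\phi_3'}{\phi_3}\sin x,\qquad h_{3,2}=\tfrac{\phi_3'}{\phi_3}\sin x, \] and, with $\langle f,g\rangle=\int_{\mathbb R} f g\,dx$, \[ \Gamma=\langle\Delta_1,h_{3,1}\rangle+2\langle\Delta_2,h_{3,2}\rangle+\big\langle\big(6x\tanh x\,\mathrm{sech}^2x-\tfrac72\mathrm{sech}^2x\big)\phi_3(1-\phi_3^2),h_{3,1}\big\rangle-2\langle E,h_{3,1}\rangle . \] Then \[ \Gamma=\frac{\pi}{\sqrt2\cosh(\pi/2)}. \]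
   Context: This $\Gamma$ is the first-order coefficient in the expansion $\gamma(p)=(p-3)\Gamma+O((p-3)^2)$ of the nonlinear Fermi Golden Rule constant $\gamma(p)$ for the linearization of the pure power NLS $i\partial_tu-\partial_x^2u-|u|^{p-1}u=0$ on $\mathbb R$ at its ground state, with suitably normalized eigenfunctions; by the authors' earlier work this coefficient is given by the explicit expression above, which is taken here as its definition. All functions are real valued functions of $x\in\mathbb R$, and primes denote $d/dx$. *)

(* Defs.v *)
From Stdlib Require Import Reals.
From Coquelicot Require Import Coquelicot.
Open Scope R_scope.

Definition sech (x : R) : R := / cosh x.

Definition phi3 (x : R) : R := sqrt 2 * sech x.
Definition dphi3 (x : R) : R := Derive phi3 x.

Definition IntR (f : R -> R) : R :=
  RInt_gen f (Rbar_locally m_infty) (Rbar_locally p_infty).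

Definition T (x : R) : R :=
  IntR (fun y => exp (- sqrt 2 * Rabs (x - y)) * (sech y) ^ 2).
Definition dT (x : R) : R := Derive T x.

Definition R1 (x : R) : R :=
  - x * phi3 x * dphi3 x
  - / (4 * sqrt 2) * (3 - phi3 x ^ 2) * T x
  - dphi3 x / (2 * sqrt 2 * phi3 x) * dT x.

Definition R2 (x : R) : R :=
  / 2 * phi3 x ^ 2 + 3 / (4 * sqrt 2) * T x
  + dphi3 x / (2 * sqrt 2 * phi3 x) * dT x.

Definition E (x : R) : R :=
  / 2 * phi3 x * (/ 4 - ln (phi3 x)) + / 2 * x * dphi3 x.

Definition F (x : R) : R := E x + phi3 x * ln (phi3 x).

Definition Delta1 (x : R) : R :=
  F x * (3 * (1 - phi3 x ^ 2) ^ 2 - 1) + phi3 x * (1 - phi3 x ^ 2) ^ 2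
  + 6 * phi3 x * (1 - phi3 x ^ 2) * R1 x - 2 * phi3 x * R2 x.

Definition Delta2 (x : R) : R :=
  F x * (1 - phi3 x ^ 2) + phi3 x * R1 x + phi3 x * (1 - phi3 x ^ 2) * R2 x.

Definition h31 (x : R) : R :=
  / 2 * phi3 x ^ 2 * cos x + dphi3 x / phi3 x * sin x.

Definition h32 (x : R) : R := dphi3 x / phi3 x * sin x.

Definition G3 (x : R) : R :=
  (6 * x * tanh x * sech x ^ 2 - 7 / 2 * sech x ^ 2) * phi3 x * (1 - phi3 x ^ 2).

(* Main.v *)
(** Every integrand is a sum of products of [sech] times a polynomial in [sech], [tanh], [x],
    [ln phi3], [T], [T'], of degree at most one in the last four, times [cos] or [sin].  As
    [T'' = 2 T - 2 sqrt 2 sech^2], such expressions are closed under differentiation, and the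
    total integrand turns out to be the derivative of a decaying expression of this kind plus
    [sech x * cos x / sqrt 2].  It remains to see that [sech x * cos x] has integral
    [PI / cosh (PI / 2)].

    Expanding [sech] in powers of [exp (- x)] gives half of this integral as
    [2 * sum (-1)^n m / (m^2 + 1)] with [m = 2 n + 1].  These terms, multiplied by
    [cosh (PI / 2)], are also the integrals of [cosh x * cos (m x)] over [0, PI / 2], so summing
    them amounts to the convergence at 0 of the Fourier series of [cosh]; comparison with
    [cos x], whose only nonzero coefficient is the first, reduces this to a
    Riemann-Lebesgue estimate for [(cosh x - cos x) / (2 sin x)]. *)

Require Import Defs.
From Stdlib Require Import Reals Lra Lia.
From Coquelicot Require Import Coquelicot.
Open Scope R_scope.

(** * Decaying functions and their integrals over the line *)

Lemma nondecreasing_of_derive (F f : R -> R) (a b : R) :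
  a <= b ->
  (forall x, a <= x <= b -> is_derive F x (f x)) ->
  (forall x, a <= x <= b -> 0 <= f x) ->
  F a <= F b.
Proof.
  intros Hab HF Hf.
  destruct (MVT_gen F a b f) as [c [Hc Heq]].
  - intros x Hx; rewrite Rmin_left, Rmax_right in Hx by lra; apply HF; lra.
  - intros x Hx; rewrite Rmin_left, Rmax_right in Hx by lra.
    apply continuity_pt_filterlim, (ex_derive_continuous F).
    exists (f x); apply HF; lra.
  - rewrite Rmin_left, Rmax_right in Hc by lra.
    assert (0 <= f c * (b - a)) by (apply Rmult_le_pos; [apply Hf|]; lra).
    lra.
Qed.

(** Both [G - F] and [G + F] have nonnegative derivatives, hence are nondecreasing. This stands in
    for the estimate of an integral by the integral of a majorant. *)
Lemma increment_le_of_derive (F f G g : R -> R) (a b : R) :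
  a <= b ->
  (forall x, a <= x <= b -> is_derive F x (f x)) ->
  (forall x, a <= x <= b -> is_derive G x (g x)) ->
  (forall x, a <= x <= b -> Rabs (f x) <= g x) ->
  Rabs (F b - F a) <= G b - G a.
Proof.
  intros Hab HF HG Hfg.
  assert (H1 : G a - F a <= G b - F b).
  { apply (nondecreasing_of_derive (fun x => G x - F x) (fun x => g x - f x)).
    - exact Hab.
    - intros x Hx; apply (is_derive_minus G F); auto.
    - intros x Hx; specialize (Hfg x Hx); apply Rabs_le_between in Hfg; lra. }
  assert (H2 : G a + F a <= G b + F b).
  { apply (nondecreasing_of_derive (fun x => G x + F x) (fun x => g x + f x)).
    - exact Hab.
    - intros x Hx; apply (is_derive_plus G F); auto.
    - intros x Hx; specialize (Hfg x Hx); apply Rabs_le_between in Hfg; lra. }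
  apply Rabs_le_between; lra.
Qed.

(** Increments of [F] are bounded by those of [G], so the Cauchy criterion passes from [G] to
    [F]. *)
Lemma filterlim_dominated_primitive (F f G g : R -> R) (z : Rbar) (lG : R) :
  (forall x, is_derive F x (f x)) ->
  (forall x, is_derive G x (g x)) ->
  (forall x, Rabs (f x) <= g x) ->
  filterlim G (Rbar_locally z) (locally lG) ->
  exists l, filterlim F (Rbar_locally z) (locally l).
Proof.
  intros HF HG Hfg HlG.
  assert (Hinc : forall u v, Rabs (F v - F u) <= Rabs (G v - G u)).
  { intros u v; destruct (Rle_or_lt u v) as [Huv|Huv].
    - eapply Rle_trans; [|apply Rle_abs].
      apply (increment_le_of_derive F f G g); auto.
    - rewrite Rabs_minus_sym, (Rabs_minus_sym (G v)).
      eapply Rle_trans; [|apply Rle_abs].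
      apply (increment_le_of_derive F f G g); auto; lra. }
  apply (proj1 (filterlim_locally_cauchy (U := R_CompleteSpace) F)); intros eps.
  destruct (proj2 (filterlim_locally_cauchy (U := R_CompleteSpace) G)
              (ex_intro _ lG HlG) eps) as [P [HP HPG]].
  exists P; split; [exact HP|intros u v Hu Hv].
  eapply Rle_lt_trans; [apply Hinc|exact (HPG u v Hu Hv)].
Qed.

(** Separate primitives at the two ends serve the integrand of [T], whose kink at [y = x] gives it
    different elementary antiderivatives on either side. The threshold [M] keeps the endpoints
    beyond such a kink. *)
Lemma is_RInt_gen_of_primitives (f Fm Fp : R -> R) (la lb : R) :
  (exists M, forall a b, a < - M -> M < b -> is_RInt f a b (Fp b - Fm a)) ->
  filterlim Fm (Rbar_locally m_infty) (locally la) ->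
  filterlim Fp (Rbar_locally p_infty) (locally lb) ->
  is_RInt_gen f (Rbar_locally m_infty) (Rbar_locally p_infty) (lb - la).
Proof.
  intros [M HM] Ha Hb.
  assert (Hl : filterlim (fun ab : R * R => Fp (snd ab) - Fm (fst ab))
            (filter_prod (Rbar_locally m_infty) (Rbar_locally p_infty))
            (locally (lb - la))).
  { eapply (filterlim_comp_2 (fun ab : R * R => Fp (snd ab))
             (fun ab : R * R => opp (Fm (fst ab))) (@plus R_NormedModule)).
    - eapply filterlim_comp; [apply filterlim_snd|exact Hb].
    - eapply filterlim_comp; [eapply filterlim_comp; [apply filterlim_fst|exact Ha]|].
      apply (filterlim_opp (V := R_NormedModule)).
    - apply (filterlim_plus lb (opp la)). }
  intros P HP.
  unfold filtermapi.
  specialize (Hl P HP); unfold filtermap in Hl.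
  destruct Hl as [Q1 Q2 HQ1 HQ2 HQ].
  apply (Filter_prod _ _ _ (fun a => Q1 a /\ a < - M) (fun b => Q2 b /\ M < b)).
  - apply filter_and; [exact HQ1|exists (- M); auto].
  - apply filter_and; [exact HQ2|exists M; auto].
  - intros a b [Qa Ma] [Qb Mb].
    exists (Fp b - Fm a); split; [apply HM; assumption|apply (HQ a b Qa Qb)].
Qed.

Lemma is_RInt_gen_of_primitive (f F : R -> R) (la lb : R) :
  (forall x, continuous f x) ->
  (forall x, is_derive F x (f x)) ->
  filterlim F (Rbar_locally m_infty) (locally la) ->
  filterlim F (Rbar_locally p_infty) (locally lb) ->
  is_RInt_gen f (Rbar_locally m_infty) (Rbar_locally p_infty) (lb - la).
Proof.
  intros Hc HF; apply is_RInt_gen_of_primitives; exists 0; intros a b _ _.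
  apply (is_RInt_derive F f); auto.
Qed.

Lemma filterlim_exp_scal_opp (k : R) (z : Rbar) :
  z = p_infty /\ 0 < k \/ z = m_infty /\ k < 0 ->
  filterlim (fun x => exp (- (k * x))) (Rbar_locally z) (locally 0).
Proof.
  intros H.
  cut (is_lim (fun x => exp (- (k * x))) z 0).
  { destruct H as [[-> _]|[-> _]]; intros H; exact H. }
  apply (is_lim_comp (fun y => exp y) (fun x => - (k * x)) z 0 m_infty).
  - apply is_lim_exp_m.
  - replace m_infty with (Rbar_opp p_infty) by reflexivity.
    apply is_lim_opp.
    replace p_infty with (Rbar_mult k z).
    + apply is_lim_scal_l, is_lim_id.
    + destruct H as [[-> Hk]|[-> Hk]]; simpl.
      * destruct (Rle_dec 0 k) as [Hk'|]; [|exfalso; lra].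
        destruct (Rle_lt_or_eq_dec 0 k Hk'); [reflexivity|exfalso; lra].
      * destruct (Rle_dec 0 k) as [Hk'|]; [exfalso; lra|reflexivity].
  - destruct H as [[-> _]|[-> _]]; exists 0; discriminate.
Qed.

(** Equivalent to a bound by [C * exp (- Rabs x / 2)]; the two smooth exponentials have explicit
    primitives, one for each end. The rate 1/2 is below the rate 1 of [sech], which leaves room for
    factors of linear growth. *)
Definition decays (f : R -> R) : Prop :=
  (forall x, continuous f x) /\
  exists C, forall x, Rabs (f x) <= C * exp (x / 2) /\ Rabs (f x) <= C * exp (- (x / 2)).

Definition bounded_continuous (f : R -> R) : Prop :=
  (forall x, continuous f x) /\ exists C, forall x, Rabs (f x) <= C.

Lemma decays_primitive (f : R -> R) :
  decays f ->
  exists F l,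
    (forall x, is_derive F x (f x)) /\
    filterlim F (Rbar_locally m_infty) (locally 0) /\
    filterlim F (Rbar_locally p_infty) (locally l).
Proof.
  intros [Hc [C HC]].
  assert (HF : forall x, is_derive (RInt f 0) x (f x)).
  { intros x; apply (is_derive_RInt f (RInt f 0) 0); [|apply Hc].
    apply filter_forall; intros y; apply (RInt_correct (V := R_CompleteNormedModule) f 0 y).
    apply (ex_RInt_continuous (V := R_CompleteNormedModule)); auto. }
  (* At each end the dominating function is a primitive of the exponential bound that tends to 0
     there. *)
  destruct (filterlim_dominated_primitive (RInt f 0) f
              (fun x => 2 * C * exp (- (- / 2 * x))) (fun x => C * exp (x / 2)) m_infty
              (2 * C * 0)) as [lm Hm].
  { exact HF. }
  { intros x; auto_derive; [auto|].
    replace (- (- / 2 * x)) with (x / 2) by field; field. }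
  { intros x; apply HC. }
  { apply (is_lim_scal_l _ (2 * C) m_infty 0), (filterlim_exp_scal_opp (- / 2) m_infty); right; split; [auto|lra]. }
  destruct (filterlim_dominated_primitive (RInt f 0) f
              (fun x => - 2 * C * exp (- (/ 2 * x))) (fun x => C * exp (- (x / 2))) p_infty
              (- 2 * C * 0)) as [lp Hp].
  { exact HF. }
  { intros x; auto_derive; [auto|].
    replace (- (/ 2 * x)) with (- (x / 2)) by field; field. }
  { intros x; apply HC. }
  { apply (is_lim_scal_l _ (- 2 * C) p_infty 0), (filterlim_exp_scal_opp (/ 2) p_infty); left; split; [auto|lra]. }
  exists (fun x => RInt f 0 x - lm), (lp - lm); split; [|split].
  - intros x; replace (f x) with (f x - 0) by ring.
    apply (is_derive_minus (RInt f 0) (fun _ => lm)); [auto|apply @is_derive_const].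
  - assert (H : is_lim (fun x => RInt f 0 x - lm) m_infty (lm - lm)).
    { apply (is_lim_minus' (RInt f 0) (fun _ => lm)); [exact Hm|apply is_lim_const]. }
    rewrite (Rminus_diag_eq lm lm eq_refl) in H; exact H.
  - apply (is_lim_minus' (RInt f 0) (fun _ => lm) p_infty); [exact Hp|apply is_lim_const].
Qed.

Lemma decays_is_RInt_gen (f : R -> R) :
  decays f ->
  exists l, is_RInt_gen f (Rbar_locally m_infty) (Rbar_locally p_infty) l.
Proof.
  intros Hf; destruct (decays_primitive f Hf) as [F [l [HF [Hm Hp]]]].
  exists (l - 0); apply (is_RInt_gen_of_primitive f F); auto; apply Hf.
Qed.

Lemma decays_lim (f : R -> R) (z : Rbar) :
  decays f -> z = p_infty \/ z = m_infty ->
  filterlim f (Rbar_locally z) (locally 0).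
Proof.
  intros [_ [C HC]] Hz.
  assert (Hk : exists k, (z = p_infty /\ 0 < k \/ z = m_infty /\ k < 0) /\
             forall x, Rabs (f x) <= C * exp (- (k * x))).
  { destruct Hz as [->| ->]; [exists (/ 2)|exists (- / 2)]; (split; [|intros x]).
    - left; split; [auto|lra].
    - replace (/ 2 * x) with (x / 2) by field; apply HC.
    - right; split; [auto|lra].
    - replace (- (- / 2 * x)) with (x / 2) by field; apply HC. }
  destruct Hk as [k [Hk Hb]].
  assert (Hg : is_lim (fun x => C * exp (- (k * x))) z 0).
  { replace 0 with (C * 0) by ring.
    apply (is_lim_scal_l _ C z 0).
    pose proof (filterlim_exp_scal_opp k z Hk) as He.
    destruct Hz as [->| ->]; exact He. }
  cut (is_lim f z 0).
  { destruct Hz as [->| ->]; intros H; exact H. }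
  apply (is_lim_le_le_loc (fun x => - (C * exp (- (k * x)))) (fun x => C * exp (- (k * x)))
           f z 0).
  - destruct Hz as [->| ->]; exists 0; intros y _; apply Rabs_le_between, Hb.
  - replace (Finite 0) with (Rbar_opp (Finite 0)) by (simpl; f_equal; ring).
    apply is_lim_opp, Hg.
  - exact Hg.
Qed.

Lemma decays_plus (f g : R -> R) :
  decays f -> decays g -> decays (fun x => f x + g x).
Proof.
  intros [Hf [C HC]] [Hg [C' HC']]; split.
  - intros x; apply (continuous_plus f g); auto.
  - exists (C + C'); intros x; destruct (HC x), (HC' x).
    split; (eapply Rle_trans; [apply Rabs_triang|]); lra.
Qed.

Lemma bounded_continuous_const (c : R) : bounded_continuous (fun _ => c).
Proof.
  split; [intros x; apply continuous_const|exists (Rabs c); intros; lra].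
Qed.

Lemma bounded_continuous_mult (f g : R -> R) :
  bounded_continuous f -> bounded_continuous g -> bounded_continuous (fun x => f x * g x).
Proof.
  intros [Hf [C HC]] [Hg [C' HC']]; split.
  - intros x; apply (continuous_mult f g); auto.
  - exists (C * C'); intros x; rewrite Rabs_mult.
    apply Rmult_le_compat; auto using Rabs_pos.
Qed.

Lemma bounded_continuous_plus (f g : R -> R) :
  bounded_continuous f -> bounded_continuous g -> bounded_continuous (fun x => f x + g x).
Proof.
  intros [Hf [C HC]] [Hg [C' HC']]; split.
  - intros x; apply (continuous_plus f g); auto.
  - exists (C + C'); intros x; eapply Rle_trans; [apply Rabs_triang|].
    apply Rplus_le_compat; auto.
Qed.

Lemma exp_le_compat (x y : R) : x <= y -> exp x <= exp y.
Proof. intros [H| ->]; [left; apply exp_increasing, H|right; reflexivity]. Qed.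

Lemma bounded_continuous_decays (f : R -> R) : decays f -> bounded_continuous f.
Proof.
  intros [Hf [C HC]]; split; [exact Hf|exists C; intros x].
  assert (0 <= C).
  { destruct (HC 0) as [H _]; pose proof (Rabs_pos (f 0)).
    replace (0 / 2) with 0 in H by field; rewrite exp_0 in H; lra. }
  destruct (HC x) as [H1 H2], (Rle_or_lt 0 x).
  - assert (exp (- (x / 2)) <= 1) by (rewrite <- exp_0; apply exp_le_compat; lra); nra.
  - assert (exp (x / 2) <= 1) by (rewrite <- exp_0; apply exp_le_compat; lra); nra.
Qed.

Lemma decays_mult (f g : R -> R) :
  decays f -> bounded_continuous g -> decays (fun x => f x * g x).
Proof.
  intros [Hf [C HC]] [Hg [C' HC']]; split.
  - intros x; apply (continuous_mult f g); auto.
  - exists (C * C'); intros x; destruct (HC x); rewrite Rabs_mult.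
    replace (C * C' * exp (x / 2)) with (C * exp (x / 2) * C') by ring.
    replace (C * C' * exp (- (x / 2))) with (C * exp (- (x / 2)) * C') by ring.
    split; apply Rmult_le_compat; auto using Rabs_pos.
Qed.

Lemma decays_ext (f g : R -> R) : (forall x, f x = g x) -> decays f -> decays g.
Proof.
  intros H [Hf [C HC]]; split.
  - intros x; apply (continuous_ext f); auto.
  - exists C; intros x; rewrite <- H; apply HC.
Qed.

Lemma decays_of_bound (f : R -> R) (C : R) :
  (forall x, continuous f x) ->
  (forall x, Rabs (f x) <= C * exp (- (Rabs x / 2))) -> decays f.
Proof.
  intros Hf HC; split; [exact Hf|exists C; intros x].
  assert (0 <= C).
  { specialize (HC x); pose proof (Rabs_pos (f x)).
    pose proof (exp_pos (- (Rabs x / 2))); nra. }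
  pose proof (Rle_abs x); pose proof (Rle_abs (- x)); rewrite Rabs_Ropp in *.
  split; (eapply Rle_trans; [apply HC|]); apply Rmult_le_compat_l;
    try apply exp_le_compat; lra.
Qed.

Lemma is_derive_continuous (f : R -> R) (x l : R) : is_derive f x l -> continuous f x.
Proof. intros H; apply (ex_derive_continuous f); exists l; exact H. Qed.

(** * Hyperbolic functions: bounds and derivatives *)

Lemma cosh_pos (x : R) : 0 < cosh x.
Proof. unfold cosh; pose proof (exp_pos x); pose proof (exp_pos (- x)); lra. Qed.

Lemma cosh_even (x : R) : cosh (- x) = cosh x.
Proof. unfold cosh; rewrite Ropp_involutive; field. Qed.

Lemma cosh_ge_1 (x : R) : 1 <= cosh x.
Proof.
  unfold cosh; pose proof (exp_ineq1_le x); pose proof (exp_ineq1_le (- x)); lra.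
Qed.

Lemma cosh_le_exp_abs (x : R) : cosh x <= exp (Rabs x).
Proof.
  unfold cosh; pose proof (Rle_abs x); pose proof (Rle_abs (- x)); rewrite Rabs_Ropp in *.
  pose proof (exp_le_compat x (Rabs x)); pose proof (exp_le_compat (- x) (Rabs x)); lra.
Qed.

Lemma sech_pos (x : R) : 0 < sech x.
Proof. apply Rinv_0_lt_compat, cosh_pos. Qed.

Lemma sech_le_1 (x : R) : sech x <= 1.
Proof. rewrite <- Rinv_1; apply Rinv_le_contravar; [lra|apply cosh_ge_1]. Qed.

Lemma sech_even (x : R) : sech (- x) = sech x.
Proof. unfold sech; rewrite cosh_even; reflexivity. Qed.

Lemma sech_le_exp_abs (x : R) : sech x <= 2 * exp (- Rabs x).
Proof.
  assert (H : exp (Rabs x) <= 2 * cosh x).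
  { unfold cosh; pose proof (exp_pos x); pose proof (exp_pos (- x)).
    unfold Rabs; destruct (Rcase_abs x); lra. }
  rewrite exp_Ropp; unfold sech; pose proof (exp_pos (Rabs x)); pose proof (cosh_pos x).
  apply (Rmult_le_reg_r (cosh x)); [lra|rewrite Rinv_l by lra].
  apply (Rmult_le_reg_r (exp (Rabs x))); [lra|].
  field_simplify; lra.
Qed.

Lemma is_derive_cosh (x : R) : is_derive cosh x (sinh x).
Proof. apply is_derive_Reals, derivable_pt_lim_cosh. Qed.

Lemma is_derive_sinh (x : R) : is_derive sinh x (cosh x).
Proof. apply is_derive_Reals, derivable_pt_lim_sinh. Qed.

Lemma is_derive_sech (x : R) : is_derive sech x (- (sech x * tanh x)).
Proof.
  pose proof (cosh_pos x).
  replace (- (sech x * tanh x)) with (- sinh x / cosh x ^ 2)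
    by (unfold sech, tanh; field; lra).
  apply (is_derive_inv cosh x (sinh x)); [apply is_derive_cosh|lra].
Qed.

Lemma tanh_sqr (x : R) : tanh x * tanh x = 1 - sech x * sech x.
Proof.
  pose proof (cosh_pos x).
  assert (H1 : cosh x * cosh x - sinh x * sinh x = 1).
  { unfold cosh, sinh; pose proof (exp_pos x); rewrite exp_Ropp; field; lra. }
  unfold sech, tanh.
  replace (sinh x / cosh x * (sinh x / cosh x)) with
    (sinh x * sinh x / (cosh x * cosh x)) by (field; lra).
  replace (sinh x * sinh x) with (cosh x * cosh x - 1) by lra.
  field; lra.
Qed.

Lemma is_derive_tanh (x : R) : is_derive tanh x (sech x * sech x).
Proof.
  pose proof (cosh_pos x).
  apply (is_derive_ext (fun y => sinh y * sech y)); [reflexivity|].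
  replace (sech x * sech x) with (cosh x * sech x + sinh x * (- (sech x * tanh x))).
  - apply (is_derive_mult sinh sech x (cosh x) (- (sech x * tanh x)));
      [apply is_derive_sinh|apply is_derive_sech|intros; apply Rmult_comm].
  - replace (sinh x) with (tanh x * cosh x) by (unfold tanh; field; lra).
    replace (cosh x * sech x + tanh x * cosh x * - (sech x * tanh x))
      with (cosh x * sech x * (1 - tanh x * tanh x)) by ring.
    rewrite tanh_sqr; unfold sech; field; lra.
Qed.

Lemma continuous_sech (x : R) : continuous sech x.
Proof. eapply is_derive_continuous, is_derive_sech. Qed.

Lemma sqrt2_sqr : sqrt 2 * sqrt 2 = 2.
Proof. apply sqrt_sqrt; lra. Qed.

Lemma sqrt2_bounds : 1 < sqrt 2 < 3 / 2.
Proof. pose proof sqrt2_sqr; pose proof (sqrt_pos 2); split; nra. Qed.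

(** * The convolution [T] *)

(** The factor [sech y ^ 2] is at most [4 * exp (- 2 * Rabs y)], and [sqrt 2 < 3 / 2] leaves a decay
    rate of at least 1/2. *)
Lemma decays_exp_sech2 : decays (fun y => exp (sqrt 2 * y) * sech y ^ 2).
Proof.
  apply (decays_of_bound _ 4).
  - intros x; eapply is_derive_continuous.
    apply (is_derive_mult (fun y => exp (sqrt 2 * y)) (fun y => sech y ^ 2)).
    + auto_derive; [auto|reflexivity].
    + apply (is_derive_pow sech 2), is_derive_sech.
    + intros; apply Rmult_comm.
  - intros x; pose proof (sech_pos x); pose proof (sech_le_exp_abs x).
    pose proof sqrt2_bounds; pose proof (exp_pos (sqrt 2 * x)).
    rewrite Rabs_right by nra.
    apply Rle_trans with (exp (sqrt 2 * Rabs x) * (4 * exp (- (2 * Rabs x)))).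
    + apply Rmult_le_compat; [lra|nra| |].
      * apply exp_le_compat, Rmult_le_compat_l; [lra|apply Rle_abs].
      * replace (- (2 * Rabs x)) with (- Rabs x + - Rabs x) by ring.
        rewrite exp_plus; pose proof (exp_pos (- Rabs x)); nra.
    + replace (exp (sqrt 2 * Rabs x) * (4 * exp (- (2 * Rabs x))))
        with (4 * exp (sqrt 2 * Rabs x + - (2 * Rabs x))) by (rewrite exp_plus; ring).
      apply Rmult_le_compat_l; [lra|apply exp_le_compat].
      pose proof (Rabs_pos x); nra.
Qed.

(* [A] is the left half of the convolution stripped of its factor [exp (- sqrt 2 x)];
   since [sech ^ 2] is even, reflecting [A] gives the right half. *)
Lemma exists_half_convolution :
  exists A : R -> R,
    (forall x, is_derive A x (exp (sqrt 2 * x) * sech x ^ 2)) /\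
    filterlim A (Rbar_locally m_infty) (locally 0) /\
    (forall x, 0 <= A x <= exp (sqrt 2 * x) / sqrt 2).
Proof.
  destruct (decays_primitive _ decays_exp_sech2) as [A [l [HA [Hm _]]]].
  exists A; split; [exact HA|split; [exact Hm|intros x]].
  pose proof sqrt2_bounds.
  (* A nondecreasing function with limit 0 at minus infinity is nonnegative. Applied to [A] and to
     [exp (sqrt 2 * y) / sqrt 2 - A y], this gives the two bounds, the second because
     [sech y <= 1]. *)
  assert (Hnn : forall (F f : R -> R), (forall y, is_derive F y (f y)) ->
            (forall y, 0 <= f y) -> is_lim F m_infty 0 -> 0 <= F x).
  { intros F f HF Hf HlF.
    apply (is_lim_le_loc F (fun _ => F x) m_infty 0 (F x));
      [|exact HlF|apply is_lim_const].
    exists x; intros y Hy;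
    apply (nondecreasing_of_derive F f); auto using Rlt_le. }
  split.
  - apply (Hnn A _ HA); [|exact Hm].
    intros y; pose proof (exp_pos (sqrt 2 * y)); nra.
  - cut (0 <= exp (sqrt 2 * x) / sqrt 2 - A x); [lra|].
    apply (Hnn (fun y => exp (sqrt 2 * y) / sqrt 2 - A y)
             (fun y => exp (sqrt 2 * y) - exp (sqrt 2 * y) * sech y ^ 2)).
    + intros y; apply (is_derive_minus (fun y => exp (sqrt 2 * y) / sqrt 2) A); [|auto].
      auto_derive; [auto|field; lra].
    + intros y; pose proof (exp_pos (sqrt 2 * y)).
      pose proof (sech_pos y); pose proof (sech_le_1 y).
      assert (sech y ^ 2 <= 1) by nra; nra.
    + replace 0 with (/ sqrt 2 * 0 - 0) by ring.
      apply is_lim_minus'; [|exact Hm].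
      apply (is_lim_ext (fun y => / sqrt 2 * exp (- (- sqrt 2 * y)))).
      * intros y; replace (- (- sqrt 2 * y)) with (sqrt 2 * y) by ring; field; lra.
      * apply (is_lim_scal_l _ (/ sqrt 2) m_infty 0).
        apply (filterlim_exp_scal_opp (- sqrt 2) m_infty); right; split; [auto|lra].
Qed.

Section HalfConvolution.

Variable A : R -> R.
Hypothesis HA : forall x, is_derive A x (exp (sqrt 2 * x) * sech x ^ 2).
Hypothesis HAlim : filterlim A (Rbar_locally m_infty) (locally 0).

Lemma is_derive_half_reflected (y : R) :
  is_derive (fun z => - A (- z)) y (exp (- (sqrt 2 * y)) * sech y ^ 2).
Proof.
  auto_derive.
  - eexists; apply HA.
  - rewrite (is_derive_unique (fun z : R => A z) _ _ (HA (- y))), sech_even.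
    replace (sqrt 2 * - y) with (- (sqrt 2 * y)) by ring; ring.
Qed.

(** The integral is split at [y = x], where the absolute value changes sign. On each side a factor
    depending only on [x] comes out, leaving the derivative of [A] on the left and of its reflection
    on the right. *)
Lemma T_half_convolution (x : R) :
  T x = exp (- (sqrt 2 * x)) * A x + exp (sqrt 2 * x) * A (- x).
Proof.
  unfold T, IntR.
  apply (is_RInt_gen_unique (V := R_CompleteNormedModule)).
  replace (exp (- (sqrt 2 * x)) * A x + exp (sqrt 2 * x) * A (- x)) with
    ((exp (sqrt 2 * x) * (A (- x) + 0)) - (exp (- (sqrt 2 * x)) * (0 - A x))) by ring.
  apply (is_RInt_gen_of_primitives _
           (fun a => exp (- (sqrt 2 * x)) * (A a - A x))
           (fun b => exp (sqrt 2 * x) * (A (- x) + - A (- b)))).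
  (* Beyond [Rabs x] on both sides the endpoints satisfy [a < x < b], so the interval can be cut at
     [x]. *)
  - exists (Rabs x); intros a b Ha Hb.
    pose proof (Rle_abs x); pose proof (Rle_abs (- x)); rewrite Rabs_Ropp in *.
    assert (Hcont : forall k y, continuous (fun y => exp (k * y) * sech y ^ 2) y).
    { intros k y; eapply is_derive_continuous.
      apply (is_derive_mult (fun y => exp (k * y)) (fun y => sech y ^ 2)).
      - auto_derive; [auto|reflexivity].
      - apply (is_derive_pow sech 2), is_derive_sech.
      - intros; apply Rmult_comm. }
    replace (exp (sqrt 2 * x) * (A (- x) + - A (- b)) - exp (- (sqrt 2 * x)) * (A a - A x))
      with (exp (- (sqrt 2 * x)) * (A x - A a) + exp (sqrt 2 * x) * (- A (- b) - - A (- x)))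
      by ring.
    apply (is_RInt_Chasles (V := R_NormedModule) _ a x b
             (exp (- (sqrt 2 * x)) * (A x - A a))
             (exp (sqrt 2 * x) * (- A (- b) - - A (- x)))).
    + apply (is_RInt_ext (fun y => exp (- (sqrt 2 * x)) * (exp (sqrt 2 * y) * sech y ^ 2))).
      { intros y; rewrite Rmin_left, Rmax_right by lra; intros Hy.
        rewrite Rabs_right, <- Rmult_assoc, <- exp_plus by lra.
        f_equal; f_equal; ring. }
      apply (is_RInt_scal (fun y => exp (sqrt 2 * y) * sech y ^ 2)).
      apply (is_RInt_derive A (fun y => exp (sqrt 2 * y) * sech y ^ 2)); auto.
    + apply (is_RInt_ext (fun y => exp (sqrt 2 * x) * (exp (- sqrt 2 * y) * sech y ^ 2))).
      { intros y; rewrite Rmin_left, Rmax_right by lra; intros Hy.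
        rewrite Rabs_left, <- Rmult_assoc, <- exp_plus by lra.
        f_equal; f_equal; ring. }
      apply (is_RInt_scal (fun y => exp (- sqrt 2 * y) * sech y ^ 2)).
      apply (is_RInt_derive (fun z => - A (- z)) (fun y => exp (- sqrt 2 * y) * sech y ^ 2));
        auto.
      intros y _; replace (- sqrt 2 * y) with (- (sqrt 2 * y)) by ring.
      apply is_derive_half_reflected.
  - apply (is_lim_scal_l (fun a => A a - A x) (exp (- (sqrt 2 * x))) m_infty (0 - A x)).
    apply is_lim_minus'; [exact HAlim|apply is_lim_const].
  - apply (is_lim_scal_l (fun b => A (- x) + - A (- b)) (exp (sqrt 2 * x)) p_infty (A (- x) + 0)).
    apply is_lim_plus'; [apply is_lim_const|].
    replace 0 with (- 0) by ring.
    apply (is_lim_opp (fun b => A (- b)) p_infty 0).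
    apply (filterlim_comp _ _ _ Ropp A _ (Rbar_locally m_infty)); [|exact HAlim].
    apply (filterlim_Rbar_opp p_infty).
Qed.

(** The terms containing the derivative of [A] cancel, since [sech] is even; only the exponential
    factors contribute. *)
Lemma is_derive_T_half (x : R) :
  is_derive T x (sqrt 2 * (exp (sqrt 2 * x) * A (- x) - exp (- (sqrt 2 * x)) * A x)).
Proof.
  apply (is_derive_ext
           (fun y => exp (- (sqrt 2 * y)) * A y + exp (sqrt 2 * y) * - - A (- y))).
  { intros y; rewrite T_half_convolution, Ropp_involutive; reflexivity. }
  auto_derive.
  - repeat split; eexists; apply HA.
  - rewrite (is_derive_unique (fun z : R => A z) _ _ (HA x)), (is_derive_unique (fun z : R => A z) _ _ (HA (- x))), sech_even.
    replace (sqrt 2 * - x) with (- (sqrt 2 * x)) by ring; ring.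
Qed.

Lemma dT_half (x : R) :
  dT x = sqrt 2 * (exp (sqrt 2 * x) * A (- x) - exp (- (sqrt 2 * x)) * A x).
Proof. apply is_derive_unique, is_derive_T_half. Qed.

(** Here the terms containing the derivative of [A] add up instead of cancelling. The kernel of [T]
    is a multiple of the Green function of [2 - d^2/dx^2], which is what makes the integrands closed
    under differentiation. *)
Lemma is_derive_dT_half (x : R) : is_derive dT x (2 * T x - 2 * sqrt 2 * sech x ^ 2).
Proof.
  apply (is_derive_ext
           (fun y => sqrt 2 * (exp (sqrt 2 * y) * A (- y) - exp (- (sqrt 2 * y)) * A y))).
  { intros y; symmetry; apply dT_half. }
  auto_derive.
  - repeat split; eexists; apply HA.
  - rewrite (is_derive_unique (fun z : R => A z) _ _ (HA x)), (is_derive_unique (fun z : R => A z) _ _ (HA (- x))), sech_even.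
    replace (sqrt 2 * - x) with (- (sqrt 2 * x)) by ring.
    rewrite T_half_convolution, exp_Ropp; pose proof (exp_pos (sqrt 2 * x)).
    field_simplify; [|lra|lra].
    replace (sqrt 2 ^ 2) with 2 by (rewrite <- sqrt2_sqr at 1; ring).
    field; lra.
Qed.

End HalfConvolution.

Lemma is_derive_T (x : R) : is_derive T x (dT x).
Proof.
  destruct exists_half_convolution as [A [HA [Hm _]]].
  rewrite (dT_half A HA Hm); apply is_derive_T_half; auto.
Qed.

Lemma is_derive_dT (x : R) : is_derive dT x (2 * T x - 2 * sqrt 2 * sech x ^ 2).
Proof.
  destruct exists_half_convolution as [A [HA [Hm _]]].
  apply (is_derive_dT_half A); auto.
Qed.

Lemma bounded_continuous_T_dT : bounded_continuous T /\ bounded_continuous dT.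
Proof.
  destruct exists_half_convolution as [A [HA [Hm Hb]]].
  pose proof sqrt2_bounds.
  (* The growth bound on [A] exactly offsets the exponential prefactor; the other half follows by
     reflection. *)
  assert (Hl : forall x, 0 <= exp (- (sqrt 2 * x)) * A x <= / sqrt 2).
  { intros x; destruct (Hb x); pose proof (exp_pos (sqrt 2 * x)).
    rewrite exp_Ropp; split.
    - apply Rmult_le_pos; [left; apply Rinv_0_lt_compat|]; lra.
    - apply (Rmult_le_reg_l (exp (sqrt 2 * x))); [lra|].
      rewrite <- Rmult_assoc, Rinv_r by lra; unfold Rdiv in *; lra. }
  assert (Hr : forall x, 0 <= exp (sqrt 2 * x) * A (- x) <= / sqrt 2).
  { intros x; replace (sqrt 2 * x) with (- (sqrt 2 * - x)) by ring; apply Hl. }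
  assert (Hinv : sqrt 2 * / sqrt 2 = 1) by (field; lra).
  split; split.
  - intros x; eapply is_derive_continuous, is_derive_T.
  - exists 2; intros x; specialize (Hl x); specialize (Hr x).
    rewrite (T_half_convolution A HA Hm); apply Rabs_le; nra.
  - intros x; eapply is_derive_continuous, is_derive_dT.
  - exists 2; intros x; specialize (Hl x); specialize (Hr x).
    rewrite (dT_half A HA Hm); apply Rabs_le; nra.
Qed.

(** * Closure properties and the basic decaying functions *)

Lemma bounded_continuous_opp (f : R -> R) :
  bounded_continuous f -> bounded_continuous (fun x => - f x).
Proof.
  intros [Hf [C HC]]; split.
  - intros x; apply (continuous_opp f); auto.
  - exists C; intros x; rewrite Rabs_Ropp; auto.
Qed.

Lemma bounded_continuous_minus (f g : R -> R) :
  bounded_continuous f -> bounded_continuous g -> bounded_continuous (fun x => f x - g x).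
Proof. intros Hf Hg; apply bounded_continuous_plus, bounded_continuous_opp; assumption. Qed.

Lemma bounded_continuous_pow (f : R -> R) (n : nat) :
  bounded_continuous f -> bounded_continuous (fun x => f x ^ n).
Proof.
  intros Hf; induction n as [|n IH]; simpl.
  - apply bounded_continuous_const.
  - apply bounded_continuous_mult; assumption.
Qed.

Lemma decays_mult_l (f g : R -> R) :
  bounded_continuous f -> decays g -> decays (fun x => f x * g x).
Proof.
  intros Hf Hg; apply (decays_ext (fun x => g x * f x)); [intros; ring|].
  apply decays_mult; assumption.
Qed.

Lemma decays_opp (f : R -> R) : decays f -> decays (fun x => - f x).
Proof.
  intros Hf; apply (decays_ext (fun x => -1 * f x)); [intros; ring|].
  apply decays_mult_l; [apply bounded_continuous_const|assumption].
Qed.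

Lemma decays_minus (f g : R -> R) :
  decays f -> decays g -> decays (fun x => f x - g x).
Proof. intros Hf Hg; apply decays_plus, decays_opp; assumption. Qed.

Lemma decays_sech : decays sech.
Proof.
  apply (decays_of_bound _ 2); [apply continuous_sech|intros x].
  pose proof (sech_pos x); rewrite Rabs_right by lra.
  eapply Rle_trans; [apply sech_le_exp_abs|].
  apply Rmult_le_compat_l; [lra|apply exp_le_compat]; pose proof (Rabs_pos x); lra.
Qed.

(** Half of the decay of [sech] absorbs the linear factor, because
    [Rabs x <= 2 * exp (Rabs x / 2)]. *)
Lemma decays_id_sech : decays (fun x => x * sech x).
Proof.
  apply (decays_of_bound _ 4).
  - intros x; apply (continuous_mult (fun y => y) sech);
      [apply continuous_id|apply continuous_sech].
  - intros x; pose proof (sech_pos x); pose proof (sech_le_exp_abs x) as Hs.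
    rewrite Rabs_mult, (Rabs_right (sech x)) by lra.
    pose proof (Rabs_pos x); pose proof (exp_ineq1_le (Rabs x / 2)).
    pose proof (exp_pos (- (Rabs x / 2))).
    assert (Hp : exp (Rabs x / 2) * exp (- (Rabs x / 2)) = 1)
      by (rewrite <- exp_plus, <- exp_0; f_equal; ring).
    replace (- Rabs x) with (- (Rabs x / 2) + - (Rabs x / 2)) in Hs by field.
    rewrite exp_plus in Hs.
    set (e := exp (- (Rabs x / 2))) in *; set (E := exp (Rabs x / 2)) in *.
    apply Rle_trans with (Rabs x * (2 * (e * e))); [apply Rmult_le_compat_l; lra|].
    apply Rle_trans with (2 * E * (2 * (e * e))); [|nra].
    apply Rmult_le_compat_r; nra.
Qed.

Lemma bounded_continuous_sech : bounded_continuous sech.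
Proof. apply bounded_continuous_decays, decays_sech. Qed.

Lemma bounded_continuous_tanh : bounded_continuous tanh.
Proof.
  split.
  - intros x; eapply is_derive_continuous, is_derive_tanh.
  - exists 1; intros x; pose proof (tanh_sqr x); apply Rabs_le; nra.
Qed.

Lemma bounded_continuous_cos : bounded_continuous cos.
Proof.
  split.
  - intros x; eapply is_derive_continuous, is_derive_cos.
  - exists 1; intros x; apply Rabs_le, COS_bound.
Qed.

Lemma bounded_continuous_sin : bounded_continuous sin.
Proof.
  split.
  - intros x; eapply is_derive_continuous, is_derive_sin.
  - exists 1; intros x; apply Rabs_le, SIN_bound.
Qed.

(** * The integrands *)

Lemma phi3_pos (x : R) : 0 < phi3 x.
Proof. apply Rmult_lt_0_compat; [apply sqrt_lt_R0; lra|apply sech_pos]. Qed.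

Lemma is_derive_phi3 (x : R) : is_derive phi3 x (- (phi3 x * tanh x)).
Proof.
  replace (- (phi3 x * tanh x)) with (sqrt 2 * - (sech x * tanh x))
    by (unfold phi3; ring).
  apply (is_derive_scal sech), is_derive_sech.
Qed.

Lemma dphi3_eq (x : R) : dphi3 x = - (phi3 x * tanh x).
Proof. apply is_derive_unique, is_derive_phi3. Qed.

Lemma dphi3_div_phi3 (x : R) : dphi3 x / phi3 x = - tanh x.
Proof. rewrite dphi3_eq; pose proof (phi3_pos x); field; lra. Qed.

Lemma is_derive_ln_phi3 (x : R) : is_derive (fun y => ln (phi3 y)) x (- tanh x).
Proof.
  pose proof (phi3_pos x).
  replace (- tanh x) with (scal (- (phi3 x * tanh x)) (/ phi3 x)).
  - apply (is_derive_comp ln phi3); [apply is_derive_ln; lra|apply is_derive_phi3].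
  - unfold scal; simpl; unfold mult; simpl; field; lra.
Qed.

(** The logarithm is [ln (sqrt 2) - ln (cosh x)], with the first term between 0 and 1 and
    [ln (cosh x)] between 0 and [Rabs x]. *)
Lemma ln_phi3_bound (x : R) : Rabs (ln (phi3 x)) <= 1 + Rabs x.
Proof.
  pose proof (cosh_pos x); pose proof (cosh_ge_1 x); pose proof sqrt2_bounds.
  assert (Hln : ln (phi3 x) = ln (sqrt 2) - ln (cosh x)).
  { unfold phi3, sech; apply ln_div; lra. }
  assert (0 <= ln (cosh x)) by (rewrite <- ln_1; apply ln_le; lra).
  assert (ln (cosh x) <= Rabs x)
    by (rewrite <- (ln_exp (Rabs x)); apply ln_le; [lra|apply cosh_le_exp_abs]).
  assert (0 <= ln (sqrt 2)) by (rewrite <- ln_1; apply ln_le; lra).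
  assert (ln (sqrt 2) <= 1).
  { rewrite <- (ln_exp 1); apply ln_le; [lra|]; pose proof (exp_ineq1_le 1); lra. }
  rewrite Hln; apply Rabs_le; pose proof (Rabs_pos x); lra.
Qed.

Lemma decays_ln_phi3_sech : decays (fun x => ln (phi3 x) * sech x).
Proof.
  destruct decays_id_sech as [_ [C HC]], decays_sech as [_ [C' HC']].
  split.
  - intros x; apply (continuous_mult (fun y => ln (phi3 y)) sech);
      [eapply is_derive_continuous, is_derive_ln_phi3|apply continuous_sech].
  - exists (C + C'); intros x; destruct (HC x) as [H1 H2], (HC' x) as [H3 H4].
    assert (Rabs (ln (phi3 x) * sech x) <= Rabs (x * sech x) + Rabs (sech x)).
    { rewrite !Rabs_mult; pose proof (ln_phi3_bound x); pose proof (Rabs_pos (sech x)); nra. }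
    split; lra.
Qed.

Ltac prove_bounded :=
  first
    [ solve [auto 3 with decay]
    | lazymatch goal with
      | |- bounded_continuous (fun x => @?f x + @?g x) =>
          apply (bounded_continuous_plus f g); prove_bounded
      | |- bounded_continuous (fun x => @?f x - @?g x) =>
          apply (bounded_continuous_minus f g); prove_bounded
      | |- bounded_continuous (fun x => - @?f x) =>
          apply (bounded_continuous_opp f); prove_bounded
      | |- bounded_continuous (fun x => @?f x * @?g x) =>
          apply (bounded_continuous_mult f g); prove_bounded
      | |- bounded_continuous (fun x => @?f x ^ ?n) =>
          apply (bounded_continuous_pow f n); prove_bounded
      | |- bounded_continuous (fun _ => ?c) => apply bounded_continuous_const
      end ].

(** In a product one factor must decay and the other be bounded; both choices are tried. Unbounded
    factors such as [x] must therefore stay grouped with a [sech]. *)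
Ltac prove_decays :=
  first
    [ solve [auto 2 with decay]
    | lazymatch goal with
      | |- decays (fun x => @?f x + @?g x) => apply (decays_plus f g); prove_decays
      | |- decays (fun x => @?f x - @?g x) => apply (decays_minus f g); prove_decays
      | |- decays (fun x => - @?f x) => apply (decays_opp f); prove_decays
      | |- decays (fun x => @?f x * @?g x) =>
          first
            [ apply (decays_mult f g); [solve [prove_decays]|solve [prove_bounded]]
            | apply (decays_mult_l f g); [solve [prove_bounded]|solve [prove_decays]] ]
      end ].

Lemma bounded_continuous_T : bounded_continuous T.
Proof. apply bounded_continuous_T_dT. Qed.

Lemma bounded_continuous_dT : bounded_continuous dT.
Proof. apply bounded_continuous_T_dT. Qed.

Create HintDb decay.
#[local] Hint Resolve bounded_continuous_sech bounded_continuous_tanh bounded_continuous_cos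
  bounded_continuous_sin decays_sech decays_id_sech decays_ln_phi3_sech
  bounded_continuous_T bounded_continuous_dT bounded_continuous_decays : decay.

Lemma decays_phi3 : decays phi3.
Proof. unfold phi3; prove_decays. Qed.
#[local] Hint Resolve decays_phi3 : decay.

(** A normal form in which [x] and [ln (phi3 x)] occur only inside the decaying units [x * sech x]
    and [ln (phi3 x) * sech x]. The formulas below for the other ingredients follow the same
    pattern; they serve both the decay proofs and the algebraic identity for the antiderivative. *)
Lemma E_eq (x : R) :
  E x = sqrt 2 * (/ 8 * sech x - / 2 * (ln (phi3 x) * sech x) - / 2 * ((x * sech x) * tanh x)).
Proof. unfold E; rewrite dphi3_eq; unfold phi3 at 1 3; field. Qed.

Lemma F_eq (x : R) :
  F x = sqrt 2 * (/ 8 * sech x + / 2 * (ln (phi3 x) * sech x) - / 2 * ((x * sech x) * tanh x)).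
Proof. unfold F; rewrite E_eq; unfold phi3 at 2; field. Qed.

Lemma phi3_sqr (x : R) : phi3 x ^ 2 = 2 * sech x ^ 2.
Proof. unfold phi3; rewrite <- sqrt2_sqr at 2; ring. Qed.

Lemma inv_sqrt2 : / sqrt 2 = sqrt 2 / 2.
Proof. pose proof sqrt2_bounds; rewrite <- sqrt2_sqr at 3; field; lra. Qed.

Lemma dphi3_div_scal_phi3 (x : R) : dphi3 x / (2 * sqrt 2 * phi3 x) = - (sqrt 2 / 4 * tanh x).
Proof.
  pose proof (phi3_pos x); pose proof sqrt2_bounds.
  replace (dphi3 x / (2 * sqrt 2 * phi3 x)) with (/ sqrt 2 * (dphi3 x / phi3 x) / 2)
    by (field; lra).
  rewrite dphi3_div_phi3, inv_sqrt2; field.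
Qed.

Lemma R1_eq (x : R) :
  Defs.R1 x = 2 * (x * sech x) * (sech x * tanh x)
         - sqrt 2 / 8 * (3 - 2 * sech x ^ 2) * T x + sqrt 2 / 4 * tanh x * dT x.
Proof.
  unfold Defs.R1; rewrite dphi3_div_scal_phi3, dphi3_eq, phi3_sqr, Rinv_mult, inv_sqrt2.
  replace (- x * phi3 x * - (phi3 x * tanh x)) with (x * tanh x * phi3 x ^ 2) by ring.
  rewrite phi3_sqr; field.
Qed.

Lemma R2_eq (x : R) :
  R2 x = sech x ^ 2 + 3 * sqrt 2 / 8 * T x - sqrt 2 / 4 * tanh x * dT x.
Proof.
  unfold R2; rewrite dphi3_div_scal_phi3, phi3_sqr.
  unfold Rdiv at 1; rewrite Rinv_mult, inv_sqrt2; field.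
Qed.

Lemma h31_eq (x : R) : h31 x = sech x ^ 2 * cos x - tanh x * sin x.
Proof. unfold h31; rewrite dphi3_div_phi3, phi3_sqr; field. Qed.

Lemma h32_eq (x : R) : h32 x = - tanh x * sin x.
Proof. unfold h32; rewrite dphi3_div_phi3; reflexivity. Qed.

Lemma G3_eq (x : R) :
  G3 x = sqrt 2 * ((x * sech x) * (6 * tanh x * sech x ^ 2 * (1 - 2 * sech x ^ 2))
                   - sech x * (7 / 2 * sech x ^ 2 * (1 - 2 * sech x ^ 2))).
Proof. unfold G3; rewrite phi3_sqr; unfold phi3; field. Qed.

(** * Decay and boundedness of the ingredients *)

Lemma decays_E : decays E.
Proof. eapply decays_ext; [intros x; symmetry; apply E_eq|]; prove_decays. Qed.

Lemma decays_F : decays F.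
Proof. eapply decays_ext; [intros x; symmetry; apply F_eq|]; prove_decays. Qed.

Lemma decays_G3 : decays G3.
Proof. eapply decays_ext; [intros x; symmetry; apply G3_eq|]; prove_decays. Qed.

Lemma bounded_continuous_ext (f g : R -> R) :
  (forall x, f x = g x) -> bounded_continuous f -> bounded_continuous g.
Proof.
  intros H [Hf [C HC]]; split.
  - intros x; apply (continuous_ext f); auto.
  - exists C; intros x; rewrite <- H; apply HC.
Qed.

Lemma bounded_continuous_R1 : bounded_continuous Defs.R1.
Proof.
  eapply bounded_continuous_ext; [intros x; symmetry; apply R1_eq|].
  prove_bounded.
Qed.

Lemma bounded_continuous_R2 : bounded_continuous R2.
Proof. eapply bounded_continuous_ext; [intros x; symmetry; apply R2_eq|]; prove_bounded. Qed.

Lemma bounded_continuous_h31 : bounded_continuous h31.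
Proof. eapply bounded_continuous_ext; [intros x; symmetry; apply h31_eq|]; prove_bounded. Qed.

Lemma bounded_continuous_h32 : bounded_continuous h32.
Proof. eapply bounded_continuous_ext; [intros x; symmetry; apply h32_eq|]; prove_bounded. Qed.

#[local] Hint Resolve decays_E decays_F decays_G3 bounded_continuous_R1 bounded_continuous_R2
  bounded_continuous_h31 bounded_continuous_h32 : decay.

Lemma decays_Delta1 : decays Delta1.
Proof. unfold Delta1; prove_decays. Qed.

Lemma decays_Delta2 : decays Delta2.
Proof. unfold Delta2; prove_decays. Qed.

#[local] Hint Resolve decays_Delta1 decays_Delta2 : decay.

(* An antiderivative of the total integrand up to a multiple of [sech * cos], to be used at
   [s = sech], [t = tanh], [l = ln phi3], [u = T], [v = T'].  The coefficients solve the linear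
   system obtained by differentiating a general combination of
   [s^i t^j {1, x, l, u, v} {cos, sin}]. *)
Definition correction (s t l u v : R -> R) (x : R) : R :=
  s x *
    (sqrt 2 * (sin x * (3 / 8 - 3 / 8 * s x ^ 2 + / 4 * s x ^ 4)
               + t x * cos x * (- 9 / 8 + / 8 * s x ^ 2 + 5 / 4 * s x ^ 4))
     + u x * (sin x * (- 2 + 5 / 2 * s x ^ 2 - s x ^ 4)
              + t x * cos x * (- 1 + 3 / 2 * s x ^ 2 - s x ^ 4))
     + v x * (cos x * (/ 2 - s x ^ 2 + s x ^ 4)
              + t x * sin x * (3 / 2 - / 2 * s x ^ 2)))
  + (l x * s x) *
      (sqrt 2 * (sin x * (3 / 2 - 5 / 2 * s x ^ 2 + s x ^ 4)
                 + t x * cos x * (3 / 2 - / 2 * s x ^ 2 + s x ^ 4)))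
  + (x * s x) *
      (sqrt 2 * (cos x * (- / 2 + 3 * s x ^ 2 - 6 * s x ^ 4 + 6 * s x ^ 6)
                 + t x * sin x * (- / 2 + 9 * s x ^ 2 - 6 * s x ^ 4))).

(** Stated for abstract functions satisfying the differential relations of [sech], [tanh],
    [ln phi3], [T] and [T'], so that after differentiation the claim is purely algebraic. *)
Lemma is_derive_correction (s t l u v : R -> R) (x : R) :
  is_derive s x (- (s x * t x)) ->
  is_derive t x (s x * s x) ->
  is_derive l x (- t x) ->
  is_derive u x (v x) ->
  is_derive v x (2 * u x - 2 * sqrt 2 * s x ^ 2) ->
  t x * t x = 1 - s x * s x ->
  let w := 1 - 2 * s x ^ 2 in
  let E := sqrt 2 * (/ 8 * s x - / 2 * (l x * s x) - / 2 * ((x * s x) * t x)) in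
  let F := sqrt 2 * (/ 8 * s x + / 2 * (l x * s x) - / 2 * ((x * s x) * t x)) in
  let r1 := 2 * (x * s x) * (s x * t x) - sqrt 2 / 8 * (3 - 2 * s x ^ 2) * u x
            + sqrt 2 / 4 * t x * v x in
  let r2 := s x ^ 2 + 3 * sqrt 2 / 8 * u x - sqrt 2 / 4 * t x * v x in
  let phi := sqrt 2 * s x in
  let g3 := sqrt 2 * ((x * s x) * (6 * t x * s x ^ 2 * w) - s x * (7 / 2 * s x ^ 2 * w)) in
  let h31 := s x ^ 2 * cos x - t x * sin x in
  let h32 := - t x * sin x in
  is_derive (correction s t l u v) x
    ((F * (3 * w ^ 2 - 1) + phi * w ^ 2 + 6 * phi * w * r1 - 2 * phi * r2) * h31
     + 2 * ((F * w + phi * r1 + phi * w * r2) * h32)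
     + g3 * h31 - 2 * (E * h31) - sqrt 2 / 2 * (s x * cos x)).
Proof.
  intros Hs Ht Hl Hu Hv Htt; intros.
  unfold correction; auto_derive.
  - repeat split; eexists; eassumption.
  - rewrite (is_derive_unique (fun z : R => s z) _ _ Hs),
      (is_derive_unique (fun z : R => t z) _ _ Ht),
      (is_derive_unique (fun z : R => l z) _ _ Hl),
      (is_derive_unique (fun z : R => u z) _ _ Hu),
      (is_derive_unique (fun z : R => v z) _ _ Hv).
    pose proof sqrt2_sqr as Hq.
    subst w E F r1 r2 phi g3 h31 h32.
    clear Hs Ht Hl Hu Hv.
    generalize (s x) (t x) (l x) (u x) (v x) (sqrt 2) (cos x) (sin x) Htt Hq.
    clear; intros s t l u v q c d Ht Hq.
    (* A polynomial identity remains, to be verified modulo [t * t = 1 - s * s] and [q * q = 2]. *)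
    field_simplify_eq.
    ring [Ht Hq].
Qed.

Lemma decays_correction : decays (correction sech tanh (fun x => ln (phi3 x)) T dT).
Proof. unfold correction; prove_decays. Qed.

Lemma is_derive_correction_total (x : R) :
  is_derive (correction sech tanh (fun x => ln (phi3 x)) T dT) x
    (Delta1 x * h31 x + 2 * (Delta2 x * h32 x) + G3 x * h31 x - 2 * (E x * h31 x)
     - sqrt 2 / 2 * (sech x * cos x)).
Proof.
  unfold Delta1, Delta2.
  rewrite !E_eq, !F_eq, !R1_eq, !R2_eq, !h31_eq, !h32_eq, !G3_eq, !phi3_sqr.
  apply (is_derive_correction sech tanh (fun x => ln (phi3 x)) T dT).
  - apply is_derive_sech.
  - apply is_derive_tanh.
  - apply is_derive_ln_phi3.
  - apply is_derive_T.
  - apply is_derive_dT.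
  - apply tanh_sqr.
Qed.

(** * The integral of [sech x * cos x] *)

Fixpoint alternating_sum (N : nat) : R :=
  match N with
  | O => 0
  | S n => alternating_sum n + (-1) ^ n * (2 * INR n + 1) / ((2 * INR n + 1) ^ 2 + 1)
  end.

Fixpoint odd_cos_sum (N : nat) (x : R) : R :=
  match N with
  | O => 0
  | S n => odd_cos_sum n x + cos ((2 * INR n + 1) * x)
  end.

(** Telescoping: [2 * sin x * cos (m * x)] is [sin ((m + 1) * x) - sin ((m - 1) * x)]. This is the
    closed form of a Dirichlet kernel with odd frequencies. *)
Lemma sin_mult_odd_cos_sum (N : nat) (x : R) :
  2 * sin x * odd_cos_sum N x = sin (2 * INR N * x).
Proof.
  induction N as [|n IH].
  - simpl; replace (2 * 0 * x) with 0 by ring; rewrite sin_0; ring.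
  - cbn [odd_cos_sum]; rewrite Rmult_plus_distr_l, IH, S_INR.
    replace (2 * INR n * x) with ((2 * INR n + 1) * x - x) by ring.
    replace (2 * (INR n + 1) * x) with ((2 * INR n + 1) * x + x) by ring.
    rewrite sin_plus, sin_minus; ring.
Qed.

Lemma sin_cos_odd_PI2 (n : nat) :
  sin ((2 * INR n + 1) * (PI / 2)) = (-1) ^ n /\ cos ((2 * INR n + 1) * (PI / 2)) = 0.
Proof.
  induction n as [|n [IHs IHc]].
  - simpl; replace ((2 * 0 + 1) * (PI / 2)) with (PI / 2) by ring.
    rewrite sin_PI2, cos_PI2; auto.
  - rewrite S_INR.
    replace ((2 * (INR n + 1) + 1) * (PI / 2)) with ((2 * INR n + 1) * (PI / 2) + PI) by field.
    rewrite neg_sin, neg_cos, IHs, IHc; simpl; split; ring.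
Qed.

(** * Fourier coefficients of [cosh] and [cos] on a quarter period *)

Lemma cosh_0 : cosh 0 = 1.
Proof. unfold cosh; rewrite Ropp_0, exp_0; field. Qed.

Lemma sinh_0 : sinh 0 = 0.
Proof. unfold sinh; rewrite Ropp_0, exp_0; field. Qed.

Lemma is_derive_cosh_cos_primitive (m x : R) :
  is_derive (fun y => (sinh y * cos (m * y) + m * cosh y * sin (m * y)) / (m ^ 2 + 1)) x
    (cosh x * cos (m * x)).
Proof.
  auto_derive; [auto|field; nra].
Qed.

(** Orthogonality of the odd cosines on [[0, PI / 2]]. Frequency 1 is treated apart because the
    general primitive has denominator [m ^ 2 - 1]. *)
Lemma cos_odd_cos_primitive (n : nat) :
  exists Q : R -> R,
    (forall x : R, is_derive Q x (cos x * cos ((2 * INR n + 1) * x))) /\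
    Q (PI / 2) - Q 0 = match n with O => PI / 4 | S _ => 0 end.
Proof.
  destruct n as [|n].
  - exists (fun x => x / 2 + sin x * cos x / 2); split.
    + intros x; auto_derive; [auto|].
      simpl; replace ((2 * 0 + 1) * x) with x by ring.
      pose proof (sin2_cos2 x) as H; unfold Rsqr in H; lra.
    + rewrite sin_PI2, cos_PI2, sin_0; field.
  - set (m := 2 * INR (S n) + 1).
    assert (Hm : 3 <= m) by (unfold m; rewrite S_INR; pose proof (pos_INR n); lra).
    exists (fun x => (m * cos x * sin (m * x) - sin x * cos (m * x)) / (m ^ 2 - 1)); split.
    + intros x; auto_derive; [auto|field; nra].
    + unfold m; destruct (sin_cos_odd_PI2 (S n)) as [_ ->].
      rewrite cos_PI2, sin_0, !Rmult_0_r, sin_0; unfold Rdiv; ring.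
Qed.

(** At [PI / 2] the odd cosines vanish and the sines alternate in sign, so each [cosh] coefficient
    is [cosh (PI / 2)] times a term of [alternating_sum]. The subtracted [cos] contributes only at
    the first frequency. *)
Lemma odd_cos_sum_primitive (N : nat) :
  exists Q : R -> R,
    (forall x : R, is_derive Q x ((cosh x - cos x) * odd_cos_sum N x)) /\
    Q (PI / 2) - Q 0 =
      cosh (PI / 2) * alternating_sum N - match N with O => 0 | S _ => PI / 4 end.
Proof.
  induction N as [|n [Q [HQ HQv]]].
  - exists (fun _ => 0); split; [|simpl; ring].
    intros x; simpl; rewrite Rmult_0_r; apply @is_derive_const.
  - destruct (cos_odd_cos_primitive n) as [Qc [HQc HQcv]].
    set (m := 2 * INR n + 1) in *.
    set (Qh := fun y => (sinh y * cos (m * y) + m * cosh y * sin (m * y)) / (m ^ 2 + 1)).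
    exists (fun x => Q x + (Qh x - Qc x)); split.
    + intros x; cbn [odd_cos_sum]; fold m.
      replace ((cosh x - cos x) * (odd_cos_sum n x + cos (m * x)))
        with ((cosh x - cos x) * odd_cos_sum n x
              + (cosh x * cos (m * x) - cos x * cos (m * x))) by ring.
      apply (is_derive_plus Q (fun x => Qh x - Qc x)); [apply HQ|].
      apply (is_derive_minus Qh Qc); [apply is_derive_cosh_cos_primitive|apply HQc].
    + replace (Q (PI / 2) + (Qh (PI / 2) - Qc (PI / 2)) - (Q 0 + (Qh 0 - Qc 0)))
        with ((Q (PI / 2) - Q 0) - (Qc (PI / 2) - Qc 0) + Qh (PI / 2) - Qh 0) by ring.
      rewrite HQv, HQcv; unfold Qh, m.
      destruct (sin_cos_odd_PI2 n) as [-> ->].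
      rewrite sinh_0, !Rmult_0_r, sin_0.
      cbn [alternating_sum]; destruct n; field; simpl; nra.
Qed.

(* Riemann-Lebesgue with an explicit rate: [g] is nonnegative and increasing, hence of bounded
   variation. *)
Lemma odd_cos_sum_primitive_bound (N : nat) (Q : R -> R) :
  (0 < N)%nat ->
  (forall x : R, is_derive Q x ((cosh x - cos x) * odd_cos_sum N x)) ->
  Rabs (Q (PI / 2) - Q 0) <= 3 * cosh (PI / 2) / (4 * INR N).
Proof.
  intros HN HQ.
  pose proof (lt_0_INR N HN) as HN'; pose proof PI_RGT_0 as HPI.
  set (g := fun x => (cosh x - cos x) / (2 * sin x)).
  set (num := fun x => (sinh x + sin x) * sin x - (cosh x - cos x) * cos x).
  set (dg := fun x => num x / (2 * sin x ^ 2)).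
  assert (Hsin : forall x, 0 < x <= PI / 2 -> 0 < sin x)
    by (intros x Hx; apply sin_gt_0; lra).
  (* The numerator of the derivative of [g] vanishes at 0 and has derivative [2 * cosh y * sin y],
     which is nonnegative here; hence [g] is nondecreasing. *)
  assert (Hnum : forall x, 0 <= x <= PI / 2 -> 0 <= num x).
  { intros x Hx.
    replace 0 with (num 0) by (unfold num; rewrite sinh_0, sin_0, cosh_0, cos_0; ring).
    apply (nondecreasing_of_derive num (fun y => 2 * cosh y * sin y)); [lra| |].
    - intros y _; unfold num; auto_derive; [auto|ring].
    - intros y Hy; pose proof (cosh_pos y).
      assert (0 <= sin y) by (apply sin_ge_0; lra); nra. }
  assert (Hdg : forall x, 0 < x <= PI / 2 -> is_derive g x (dg x)).
  { intros x Hx; specialize (Hsin x Hx); unfold g, dg, num; auto_derive; [lra|field; lra]. }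
  assert (Hdg0 : forall x, 0 < x <= PI / 2 -> 0 <= dg x).
  { intros x Hx; specialize (Hsin x Hx); apply Rmult_le_pos; [apply Hnum; lra|].
    left; apply Rinv_0_lt_compat; nra. }
  assert (Hg0 : forall x, 0 < x <= PI / 2 -> 0 <= g x).
  { intros x Hx; specialize (Hsin x Hx); apply Rmult_le_pos.
    - pose proof (cosh_ge_1 x); pose proof (COS_bound x); lra.
    - left; apply Rinv_0_lt_compat; lra. }
  assert (Hg1 : g (PI / 2) = cosh (PI / 2) / 2)
    by (unfold g; rewrite sin_PI2, cos_PI2; field).
  (* The quotient [g] has a vanishing denominator at 0, so the estimate is first made on
     [[d, PI / 2]], uniformly in [d]. *)
  assert (Hinner : forall d, 0 < d <= PI / 2 ->
            Rabs (Q (PI / 2) - Q d) <= 3 * cosh (PI / 2) / (4 * INR N)).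
  { intros d Hd.
    assert (Hgd : g d <= g (PI / 2)).
    { apply (nondecreasing_of_derive g dg); [lra| |]; intros x Hx;
        [apply Hdg|apply Hdg0]; lra. }
    set (k := / (2 * INR N)).
    assert (Hk : 0 < k) by (apply Rinv_0_lt_compat; lra).
    assert (HkN : k * (2 * INR N) = 1) by (unfold k; field; lra).
    (* Integration by parts: the integrand is [g x * sin (2 * INR N * x)], and adding this boundary
       term to [Q] leaves the derivative [k * (dg x * cos (2 * INR N * x))], dominated by that of
       [k * g]. *)
    set (H := fun x => Q x + k * (g x * cos (2 * INR N * x))).
    assert (HH : Rabs (H (PI / 2) - H d) <= k * g (PI / 2) - k * g d).
    { apply (increment_le_of_derive H (fun x => k * (dg x * cos (2 * INR N * x)))
               (fun x => k * g x) (fun x => k * dg x)); [lra| | |]; intros x Hx.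
      - assert (Hx' : 0 < x <= PI / 2) by lra.
        unfold H; auto_derive.
        + repeat split; eexists; [apply HQ|apply Hdg, Hx'].
        + rewrite (is_derive_unique (fun z : R => Q z) _ _ (HQ x)),
            (is_derive_unique (fun z : R => g z) _ _ (Hdg x Hx')).
          pose proof (sin_mult_odd_cos_sum N x) as HD.
          rewrite <- HD; unfold g; specialize (Hsin x Hx').
          replace (1 * ((cosh x - cos x) * odd_cos_sum N x) +
                   k * (1 * dg x * cos (2 * INR N * x) +
                   (cosh x - cos x) / (2 * sin x) *
                   (2 * INR N * 1 * - (2 * sin x * odd_cos_sum N x)))) with
            (k * (dg x * cos (2 * INR N * x))
             + (cosh x - cos x) * odd_cos_sum N x * (1 - k * (2 * INR N)))
            by (field; lra).
          rewrite HkN; ring.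
      - apply (is_derive_scal g), Hdg; lra.
      - rewrite !Rabs_mult, (Rabs_right k), (Rabs_right (dg x)).
        + apply Rmult_le_compat_l; [lra|].
          rewrite <- (Rmult_1_r (dg x)) at 2.
          apply Rmult_le_compat_l; [apply Hdg0; lra|apply Rabs_le, COS_bound].
        + apply Rle_ge, Hdg0; lra.
        + lra. }
    apply Rabs_le_between in HH; unfold H in HH.
    assert (Hcos : forall y, 0 <= g y -> Rabs (k * (g y * cos (2 * INR N * y))) <= k * g y).
    { intros y Hy; rewrite !Rabs_mult, (Rabs_right k), (Rabs_right (g y)) by lra.
      apply Rmult_le_compat_l; [lra|].
      rewrite <- (Rmult_1_r (g y)) at 2.
      apply Rmult_le_compat_l; [lra|apply Rabs_le, COS_bound]. }
    assert (H1 := proj1 (Rabs_le_between _ _) (Hcos (PI / 2) (Hg0 (PI / 2) ltac:(lra)))).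
    assert (H2 := proj1 (Rabs_le_between _ _) (Hcos d (Hg0 d Hd))).
    assert (k * g d <= k * g (PI / 2)) by (apply Rmult_le_compat_l; lra).
    (* The increment of [H] and the two boundary terms are each at most [k * g (PI / 2)] in absolute
       value. *)
    replace (3 * cosh (PI / 2) / (4 * INR N)) with (3 * (k * g (PI / 2)))
      by (rewrite Hg1; unfold k; field; lra).
    apply Rabs_le; lra. }
  destruct (Rle_or_lt (Rabs (Q (PI / 2) - Q 0)) (3 * cosh (PI / 2) / (4 * INR N)))
    as [Hle|Hlt]; [exact Hle|exfalso].
  (* If the bound failed by [eps], continuity of [Q] at 0 would make it fail on some [[z, PI / 2]]
     with [z > 0]. *)
  set (eps := Rabs (Q (PI / 2) - Q 0) - 3 * cosh (PI / 2) / (4 * INR N)).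
  assert (Heps : 0 < eps) by (unfold eps; lra).
  assert (Hc : continuous Q 0) by (eapply is_derive_continuous, HQ).
  destruct (proj1 (filterlim_locally Q (Q 0)) Hc (mkposreal eps Heps)) as [[d Hd0] Hd].
  assert (Hm : 0 < Rmin (d / 2) (PI / 2)) by (apply Rmin_pos; lra).
  pose proof (Rmin_l (d / 2) (PI / 2)); pose proof (Rmin_r (d / 2) (PI / 2)).
  set (z := Rmin (d / 2) (PI / 2)) in *.
  assert (Hz : Rabs (Q z - Q 0) < eps).
  { apply Hd; change (Rabs (z - 0) < d); rewrite Rminus_0_r, Rabs_right; lra. }
  specialize (Hinner z ltac:(lra)).
  pose proof (Rabs_triang (Q (PI / 2) - Q z) (Q z - Q 0)) as Htri.
  replace (Q (PI / 2) - Q z + (Q z - Q 0)) with (Q (PI / 2) - Q 0) in Htri by ring.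
  unfold eps in Hz; lra.
Qed.

Lemma alternating_sum_bound (n : nat) :
  Rabs (cosh (PI / 2) * alternating_sum (S n) - PI / 4)
  <= 3 * cosh (PI / 2) / (4 * INR (S n)).
Proof.
  destruct (odd_cos_sum_primitive (S n)) as [Q [HQ HQv]].
  rewrite <- HQv; apply odd_cos_sum_primitive_bound; [lia|exact HQ].
Qed.

(** * The half-line integral as an alternating series *)

Lemma exp_opp_cos_primitive (m : R) :
  0 < m ->
  exists P : R -> R,
    (forall x : R, is_derive P x (exp (- (m * x)) * cos x)) /\
    P 0 = - m / (m ^ 2 + 1) /\
    filterlim P (Rbar_locally p_infty) (locally 0).
Proof.
  intros Hm.
  exists (fun x => (sin x - m * cos x) / (m ^ 2 + 1) * exp (- (m * x))); split; [|split].
  - intros x; auto_derive; [auto|field; nra].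
  - rewrite sin_0, cos_0, Rmult_0_r, Ropp_0, exp_0; field; nra.
  - cut (is_lim (fun x => (sin x - m * cos x) / (m ^ 2 + 1) * exp (- (m * x))) p_infty 0);
      [intros H; exact H|].
    assert (He : forall c, is_lim (fun x => c * exp (- (m * x))) p_infty 0).
    { intros c; rewrite <- (Rmult_0_r c).
      apply (is_lim_scal_l _ c p_infty 0), (filterlim_exp_scal_opp m p_infty); auto. }
    apply (is_lim_le_le_loc (fun x => - (1 + m) * exp (- (m * x)))
             (fun x => (1 + m) * exp (- (m * x)))); [|apply He|apply He].
    exists 0; intros x _.
    assert (Hk : 0 < / (m ^ 2 + 1) <= 1).
    { split; [apply Rinv_0_lt_compat; nra|].
      rewrite <- Rinv_1; apply Rinv_le_contravar; nra. }
    pose proof (exp_pos (- (m * x))); pose proof (SIN_bound x); pose proof (COS_bound x).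
    assert (- (1 + m) <= sin x - m * cos x <= 1 + m) by nra.
    unfold Rdiv; split; apply Rmult_le_compat_r; nra.
Qed.

(* [l] is the half-line integral of [exp (- 2 N x) sech x cos x]; consecutive ones add up to an
   elementary integral because [1 + exp (- 2 x) = 2 exp (- x) cosh x]. *)
Lemma exp_sech_cos_primitive (l0 : R) (Q0 : R -> R) (N : nat) :
  (forall x : R, is_derive Q0 x (sech x * cos x)) ->
  Q0 0 = 0 ->
  filterlim Q0 (Rbar_locally p_infty) (locally l0) ->
  exists (Q : R -> R) (l : R),
    (forall x : R, is_derive Q x (exp (- (2 * INR N * x)) * (sech x * cos x))) /\
    Q 0 = 0 /\
    filterlim Q (Rbar_locally p_infty) (locally l) /\
    (-1) ^ N * l = l0 - 2 * alternating_sum N.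
Proof.
  intros HQ0 HQ00 Hl0; induction N as [|n [Q [l [HQ [HQz [Hl Hlv]]]]]].
  - exists Q0, l0; split; [|split; [exact HQ00|split; [exact Hl0|]]].
    + intros x; simpl; replace (- (2 * 0 * x)) with 0 by ring.
      rewrite exp_0, Rmult_1_l; apply HQ0.
    + simpl; ring.
  - set (m := 2 * INR n + 1).
    assert (Hm : 0 < m) by (unfold m; pose proof (pos_INR n); lra).
    destruct (exp_opp_cos_primitive m Hm) as [P [HP [HP0 HPl]]].
    exists (fun x => 2 * (P x - P 0) - Q x), (2 * (0 - P 0) - l); split; [|split; [|split]].
    + intros x.
      replace (exp (- (2 * INR (S n) * x)) * (sech x * cos x))
        with (2 * (exp (- (m * x)) * cos x - 0) - exp (- (2 * INR n * x)) * (sech x * cos x)).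
      * apply (is_derive_minus (fun x => 2 * (P x - P 0)) Q); [|apply HQ].
        apply (is_derive_scal (fun x => P x - P 0)).
        apply (is_derive_minus P (fun _ => P 0)); [apply HP|apply @is_derive_const].
      * rewrite S_INR.
        replace (- (2 * (INR n + 1) * x)) with (- (m * x) + - x) by (unfold m; ring).
        replace (- (2 * INR n * x)) with (- (m * x) + x) by (unfold m; ring).
        rewrite !exp_plus; pose proof (cosh_pos x).
        replace (2 * (exp (- (m * x)) * cos x - 0))
          with (exp (- (m * x)) * (2 * cosh x) * (sech x * cos x))
          by (unfold sech; field; lra).
        unfold cosh; field.
    + rewrite HQz; ring.
    + apply (is_lim_minus' (fun x => 2 * (P x - P 0)) Q p_infty); [|exact Hl].
      apply (is_lim_scal_l (fun x => P x - P 0) 2 p_infty (0 - P 0)).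
      apply (is_lim_minus' P (fun _ => P 0)); [exact HPl|apply is_lim_const].
    + cbn [alternating_sum]; fold m.
      transitivity ((-1) ^ n * l - 2 * ((-1) ^ n * m / (m ^ 2 + 1))).
      * rewrite HP0; simpl; field; nra.
      * rewrite Hlv; ring.
Qed.

(** Since [sech x * cos x] is at most 1 in absolute value, the integral is dominated by that of
    [exp (- (2 * INR N * x))]. This controls the remainder of the series after [N] terms. *)
Lemma exp_sech_cos_bound (N : nat) (Q : R -> R) (l : R) :
  (0 < N)%nat ->
  (forall x : R, is_derive Q x (exp (- (2 * INR N * x)) * (sech x * cos x))) ->
  Q 0 = 0 ->
  filterlim Q (Rbar_locally p_infty) (locally l) ->
  Rabs l <= / (2 * INR N).
Proof.
  intros HN HQ HQ0 Hl; pose proof (lt_0_INR N HN) as HN'.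
  set (k := 2 * INR N) in *.
  assert (Hk : 0 < k) by (unfold k; lra).
  assert (Hb : forall b, 0 < b -> - / k <= Q b <= / k).
  { intros b Hb; apply Rabs_le_between.
    rewrite <- (Rminus_0_r (Q b)), <- HQ0.
    apply Rle_trans with (- / k * exp (- (k * b)) - - / k * exp (- (k * 0))).
    - apply (increment_le_of_derive Q (fun x => exp (- (k * x)) * (sech x * cos x))
               (fun x => - / k * exp (- (k * x))) (fun x => exp (- (k * x)))); [lra|auto| |].
      + intros x _; auto_derive; [auto|field; lra].
      + intros x _; pose proof (exp_pos (- (k * x))).
        rewrite Rabs_mult, Rabs_right by lra.
        rewrite <- (Rmult_1_r (exp (- (k * x)))) at 2; apply Rmult_le_compat_l; [lra|].
        pose proof (sech_pos x); pose proof (sech_le_1 x); pose proof (COS_bound x).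
        apply Rabs_le; nra.
    - rewrite Rmult_0_r, Ropp_0, exp_0.
      assert (0 < / k) by (apply Rinv_0_lt_compat; lra).
      pose proof (exp_pos (- (k * b))); nra. }
  apply Rabs_le; split.
  - apply (is_lim_le_loc (fun _ => - / k) Q p_infty (- / k) l); [|apply is_lim_const|exact Hl].
    exists 0; intros b Hb0; apply Hb, Hb0.
  - apply (is_lim_le_loc Q (fun _ => / k) p_infty l (/ k)); [|exact Hl|apply is_lim_const].
    exists 0; intros b Hb0; apply Hb, Hb0.
Qed.

Lemma eq_0_of_le_inv_nat (a C : R) : (forall n, Rabs a <= C / INR (S n)) -> a = 0.
Proof.
  intros H; destruct (Req_dec a 0) as [|Ha]; [assumption|exfalso].
  pose proof (Rabs_pos_lt a Ha) as Hpos.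
  destruct (nfloor_ex (Rmax 0 (C / Rabs a)) (Rmax_l _ _)) as [n [_ Hn]].
  pose proof (Rmax_r 0 (C / Rabs a)); specialize (H n); rewrite S_INR in H.
  pose proof (pos_INR n).
  assert (HC : C / Rabs a < INR n + 1) by lra.
  apply (Rmult_lt_compat_r (Rabs a)) in HC; [|lra].
  apply (Rmult_le_compat_r (INR n + 1)) in H; [|lra].
  replace (C / Rabs a * Rabs a) with C in HC by (field; lra).
  replace (C / (INR n + 1) * (INR n + 1)) with C in H by (field; lra).
  lra.
Qed.

Lemma sech_cos_half_integral (Q : R -> R) (l : R) :
  (forall x : R, is_derive Q x (sech x * cos x)) ->
  Q 0 = 0 ->
  filterlim Q (Rbar_locally p_infty) (locally l) ->
  l = PI / (2 * cosh (PI / 2)).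
Proof.
  intros HQ HQ0 Hl; set (c := cosh (PI / 2)); pose proof (cosh_pos (PI / 2)) as Hc; fold c in Hc.
  cut (c * l - PI / 2 = 0).
  { intros H; replace (PI / (2 * c)) with (PI / 2 / c) by (field; lra).
    replace (PI / 2) with (c * l) by lra; field; lra. }
  (* With [N = INR (S n)], the series remainder costs [c / (2 * N)] and twice the Riemann-Lebesgue
     error costs [3 * c / (2 * N)], in total [2 * c / N]. *)
  apply (eq_0_of_le_inv_nat _ (2 * c)); intros n.
  destruct (exp_sech_cos_primitive l Q (S n) HQ HQ0 Hl) as [Q' [l' [H1 [H2 [H3 H4]]]]].
  pose proof (exp_sech_cos_bound (S n) Q' l' ltac:(lia) H1 H2 H3) as Hb.
  pose proof (alternating_sum_bound n) as Ha; fold c in Ha.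
  set (N := INR (S n)) in *.
  assert (HN : 0 < N) by (apply lt_0_INR; lia).
  assert (Hb' : Rabs (l - 2 * alternating_sum (S n)) <= / (2 * N)).
  { rewrite <- H4, Rabs_mult, pow_1_abs, Rmult_1_l; exact Hb. }
  replace (c * l - PI / 2) with
    (c * (l - 2 * alternating_sum (S n)) + 2 * (c * alternating_sum (S n) - PI / 4)) by field.
  eapply Rle_trans; [apply Rabs_triang|].
  rewrite !Rabs_mult, (Rabs_right c), (Rabs_right 2) by lra.
  replace (2 * c / N) with (c * / (2 * N) + 2 * (3 * c / (4 * N))) by (field; lra).
  apply Rplus_le_compat; apply Rmult_le_compat_l; lra.
Qed.

Lemma is_RInt_gen_sech_cos :
  is_RInt_gen (fun x => sech x * cos x) (Rbar_locally m_infty) (Rbar_locally p_infty)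
    (PI / cosh (PI / 2)).
Proof.
  assert (Hdec : decays (fun x => sech x * cos x)) by prove_decays.
  destruct (decays_primitive _ Hdec) as [P [l [HP [Hm Hp]]]].
  assert (Hhalf : l - P 0 = PI / (2 * cosh (PI / 2))).
  { apply (sech_cos_half_integral (fun x => P x - P 0)).
    - intros x; rewrite <- (Rminus_0_r (sech x * cos x)).
      apply (is_derive_minus P (fun _ => P 0)); [apply HP|apply @is_derive_const].
    - ring.
    - apply (is_lim_minus' P (fun _ => P 0) p_infty); [exact Hp|apply is_lim_const]. }
  assert (Heven : l = PI / (2 * cosh (PI / 2)) + P 0) by lra.
  (* The integrand is even, so [P x + P (- x)] has derivative 0; the increment bound with majorant 0
     makes it constant. *)
  assert (Href : forall x, - P (- x) - - P 0 = P x - P 0).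
  { assert (Hd : forall x : R, is_derive (fun y => P y + P (- y)) x 0).
    { intros x; auto_derive.
      - split; [eexists; apply HP|split; [eexists; apply HP|auto]].
      - rewrite (is_derive_unique (fun z : R => P z) _ _ (HP x)),
          (is_derive_unique (fun z : R => P z) _ _ (HP (- x))), sech_even, cos_neg; ring. }
    assert (Hc : forall a b : R, a <= b -> P b + P (- b) = P a + P (- a)).
    { intros a b Hab.
      pose proof (increment_le_of_derive _ _ (fun _ => 0) (fun _ => 0) a b Hab
                    (fun x _ => Hd x) (fun x _ => is_derive_const (0 : R_NormedModule) x)
                    (fun _ _ => Req_le _ _ Rabs_R0)) as H.
      simpl in H; apply Rabs_le_between in H; lra. }
    intros x; destruct (Rle_or_lt 0 x) as [Hx|Hx].
    - specialize (Hc 0 x Hx); rewrite Ropp_0 in Hc; lra.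
    - specialize (Hc x 0 (Rlt_le _ _ Hx)); rewrite Ropp_0 in Hc; lra. }
  (* Letting [x] tend to infinity in [P x + P (- x) = 2 * P 0], where [P] vanishes at minus
     infinity, shows that the two half-line integrals agree. *)
  assert (Hl : l - P 0 = P 0).
  { assert (H1 : is_lim (fun x => P x + P (- x)) p_infty (l + 0)).
    { apply is_lim_plus'; [exact Hp|].
      apply (filterlim_comp _ _ _ Ropp P _ (Rbar_locally m_infty)); [|exact Hm].
      apply (filterlim_Rbar_opp p_infty). }
    assert (H2 : is_lim (fun x => P x + P (- x)) p_infty (2 * P 0)).
    { apply (is_lim_ext (fun _ => 2 * P 0)); [|apply is_lim_const].
      intros y; specialize (Href y); lra. }
    apply is_lim_unique in H1; apply is_lim_unique in H2; rewrite H1 in H2.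
    injection H2; lra. }
  replace (PI / cosh (PI / 2)) with (l - 0).
  - apply (is_RInt_gen_of_primitive _ P); auto; apply Hdec.
  - pose proof (cosh_pos (PI / 2)).
    replace (PI / cosh (PI / 2)) with (2 * (PI / (2 * cosh (PI / 2)))) by (field; lra); lra.
Qed.

(* Gamma = <Delta1,h31> + 2<Delta2,h32> + <G3,h31> - 2<E,h31>, each pairing
   being a convergent improper integral over R, and Gamma = pi/(sqrt2 cosh(pi/2)). *)
Theorem theorem1p3 :
  exists I1 I2 I3 I4 : R,
    is_RInt_gen (fun x => Delta1 x * h31 x) (Rbar_locally m_infty) (Rbar_locally p_infty) I1 /\
    is_RInt_gen (fun x => Delta2 x * h32 x) (Rbar_locally m_infty) (Rbar_locally p_infty) I2 /\
    is_RInt_gen (fun x => G3 x * h31 x) (Rbar_locally m_infty) (Rbar_locally p_infty) I3 /\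
    is_RInt_gen (fun x => E x * h31 x) (Rbar_locally m_infty) (Rbar_locally p_infty) I4 /\
    I1 + 2 * I2 + I3 - 2 * I4 = PI / (sqrt 2 * cosh (PI / 2)).
Proof.
  assert (D1 : decays (fun x => Delta1 x * h31 x)) by prove_decays.
  assert (D2 : decays (fun x => Delta2 x * h32 x)) by prove_decays.
  assert (D3 : decays (fun x => G3 x * h31 x)) by prove_decays.
  assert (D4 : decays (fun x => E x * h31 x)) by prove_decays.
  destruct (decays_is_RInt_gen _ D1) as [I1 H1], (decays_is_RInt_gen _ D2) as [I2 H2],
    (decays_is_RInt_gen _ D3) as [I3 H3], (decays_is_RInt_gen _ D4) as [I4 H4].
  exists I1, I2, I3, I4; repeat (split; [assumption|]).
  set (total := fun x => Delta1 x * h31 x + 2 * (Delta2 x * h32 x) + G3 x * h31 x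
                         - 2 * (E x * h31 x) - sqrt 2 / 2 * (sech x * cos x)).
  (* The antiderivative [correction] tends to 0 at both ends, so [total] integrates to 0. *)
  assert (Hzero : is_RInt_gen total (Rbar_locally m_infty) (Rbar_locally p_infty) (0 - 0)).
  { apply (is_RInt_gen_of_primitive total
             (correction sech tanh (fun x => ln (phi3 x)) T dT)).
    - assert (H : decays total) by (unfold total; prove_decays); apply H.
    - apply is_derive_correction_total.
    - apply decays_lim; [apply decays_correction|auto].
    - apply decays_lim; [apply decays_correction|auto]. }
  (* The same integral by linearity; uniqueness of its value then yields the required equation. *)
  assert (Hsum : is_RInt_gen total (Rbar_locally m_infty) (Rbar_locally p_infty)
            (I1 + 2 * I2 + I3 - 2 * I4 - sqrt 2 / 2 * (PI / cosh (PI / 2)))).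
  { apply (is_RInt_gen_minus (V := R_NormedModule)
             (fun x => Delta1 x * h31 x + 2 * (Delta2 x * h32 x) + G3 x * h31 x
                       - 2 * (E x * h31 x)) (fun x => sqrt 2 / 2 * (sech x * cos x))).
    2: apply (is_RInt_gen_scal (fun x => sech x * cos x)), is_RInt_gen_sech_cos.
    apply (is_RInt_gen_minus (V := R_NormedModule)
             (fun x => Delta1 x * h31 x + 2 * (Delta2 x * h32 x) + G3 x * h31 x)
             (fun x => 2 * (E x * h31 x))).
    2: apply (is_RInt_gen_scal (fun x => E x * h31 x)), H4.
    apply (is_RInt_gen_plus (V := R_NormedModule)
             (fun x => Delta1 x * h31 x + 2 * (Delta2 x * h32 x)) (fun x => G3 x * h31 x)).
    2: exact H3.
    apply (is_RInt_gen_plus (V := R_NormedModule)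
             (fun x => Delta1 x * h31 x) (fun x => 2 * (Delta2 x * h32 x))).
    1: exact H1.
    apply (is_RInt_gen_scal (fun x => Delta2 x * h32 x)), H2. }
  apply (is_RInt_gen_unique (V := R_CompleteNormedModule)) in Hzero, Hsum.
  rewrite Hzero in Hsum.
  pose proof (cosh_pos (PI / 2)); pose proof sqrt2_bounds.
  replace (PI / (sqrt 2 * cosh (PI / 2))) with (/ sqrt 2 * (PI / cosh (PI / 2)))
    by (field; lra).
  rewrite inv_sqrt2; lra.
Qed.
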